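(* Let $0<\alpha_1,\alpha_2<\infty$ and let $(X,Y)$ be a pair of real-valued random variables with distributions $F\in\mathcal{R}_{-\alpha_1}$, $G\in\mathcal{R}_{-\alpha_2}$ respectively, such that $(X,Y)\in\mathcal{R}^{(2)}_{(-\alpha_1,-\alpha_2)}$. Let $(\Theta,\Delta)$ be a random pair, independent of $(X,Y)$, with $\Theta,\Delta$ non-negative and non-degenerate to zero, such that $\mathbf{E}[\Theta^{\alpha_1+\varepsilon}\Delta^{\alpha_2+\varepsilon}]<\infty$ for some $\varepsilon>0$. If Assumption A holds, then $$\mathbf{P}[\Theta X>x,\,\Delta Y>y]\sim\mathbf{E}[\Theta^{\alpha_1}\Delta^{\alpha_2}]\,\mathbf{P}[X>x,\,Y>y]\qquad\text{as }x\wedge y\to\infty,$$ and furthermore $(\Theta X,\Delta Y)\in\mathcal{R}^{(2)}_{(-\alpha_1,-\alpha_2)}$.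
   Context: $\overline F=1-F$, $x\wedge y=\min\{x,y\}$. For positive functions, $f\sim g$ means $f/g\to1$ and $f=o(g)$ means $f/g\to0$ in the indicated limit. Ratios and $o$-relations involving joint tails presuppose that the joint tail in the denominator is positive. $\Theta$ and $\Delta$ may be arbitrarily dependent; ''non-degenerate to zero'' means not almost surely equal to $0$. $F\in\mathcal{R}_{-\alpha}$ ($\alpha>0$) if $\overline F(x)>0$ for all $x$ and $\lim_{x\to\infty}\overline F(tx)/\overline F(x)=t^{-\alpha}$ for all $t>0$. A pair $(X,Y)$ with marginals $F,G$ satisfies $(X,Y)\in\mathcal{R}^{(2)}_{(-\alpha_1,-\alpha_2)}$ if $F\in\mathcal{R}_{-\alpha_1}$, $G\in\mathcal{R}_{-\alpha_2}$ and $\lim_{x\wedge y\to\infty}\mathbf{P}[X>t_1x,Y>t_2y]/\mathbf{P}[X>x,Y>y]=t_1^{-\alpha_1}t_2^{-\alpha_2}$ for all $t_1,t_2>0$. Assumption A: there exist functions $b,c:[0,\infty)\to(0,\infty)$ with $b(x)\to\infty$, $b(x)=o(x)$ as $x\to\infty$, and $c(y)\to\infty$, $c(y)=o(y)$ as $y\to\infty$, such that, as $x\wedge y\to\infty$, $\mathbf{P}[\Theta>b(x)]=o(\mathbf{P}[\Theta X>x,\Delta Y>y])$ and $\mathbf{P}[\Delta>c(y)]=o(\mathbf{P}[\Theta X>x,\Delta Y>y])$. *)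

(* Defs.v *)
From HB Require Import structures.
From mathcomp Require Import all_boot all_order all_algebra.
From mathcomp Require Import all_classical all_reals all_analysis.
From mathcomp Require Import measurable_realfun.

Set Implicit Arguments.
Unset Strict Implicit.
Unset Printing Implicit Defensive.

Import Order.TTheory GRing.Theory Num.Theory.
Import numFieldNormedType.Exports.

Local Open Scope classical_set_scope.
Local Open Scope ring_scope.

(* The filter "x /\ y --> +oo" on pairs (x, y), where x /\ y = min {x, y}. *)
Definition min_pinfty (R : realType) : set_system (R * R) :=
  filter_from setT (fun M : R => [set p | M < Num.min p.1 p.2]).

Global Instance min_pinfty_filter (R : realType) :
  ProperFilter (@min_pinfty R).
Proof.
apply: filter_from_proper.
  apply: filter_fromT_filter; first by exists 0.
  move=> M N; exists (Num.max M N) => p /=; by rewrite gt_max => /andP[].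
by move=> M _; exists (M + 1, M + 1) => /=; rewrite minxx ltrDl.
Qed.

(* Since x / 0 = 0, the positivity of the functions divided by has to be
   required explicitly in the three definitions below. In [asym_o] nothing is
   asked of the numerator f, which may vanish. *)
Definition asym_o (R : realType) (T : Type) (L : set_system T) (f g : T -> R)
    : Prop :=
  (\forall p \near L, 0 < g p) /\ f p / g p @[p --> L] --> (0 : R).

Definition asym_equiv (R : realType) (T : Type) (L : set_system T)
    (f g : T -> R) : Prop :=
  [/\ \forall p \near L, 0 < f p,
      \forall p \near L, 0 < g p
    & f p / g p @[p --> L] --> (1 : R)].

(* F \in R_{-a} *)
Definition regularly_varying (R : realType) (F : R -> R) (a : R) : Prop :=
  (forall x : R, 0 < 1 - F x) /\
  (forall t : R, 0 < t ->
     (1 - F (t * x)) / (1 - F x) @[x --> +oo] --> t `^ (- a)).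

Section probability.
Context (d : measure_display) (Omega : measurableType d) (R : realType)
  (P : probability Omega R).

Definition distr_fun (X : {RV P >-> R}) : R -> R := fun x => fine (cdf X x).

Definition tail (X : Omega -> R) (x : R) : R := fine (P [set w | x < X w]).

Definition joint_tail (X Y : Omega -> R) (p : R * R) : R :=
  fine (P [set w | p.1 < X w /\ p.2 < Y w]).

(* (X, Y) \in R^(2)_{(-a1, -a2)} *)
Definition bi_regularly_varying (X Y : {RV P >-> R}) (a1 a2 : R) : Prop :=
  [/\ regularly_varying (distr_fun X) a1,
      regularly_varying (distr_fun Y) a2,
      \forall p \near @min_pinfty R, 0 < joint_tail X Y p
    & forall t1 t2 : R, 0 < t1 -> 0 < t2 ->
        joint_tail X Y (t1 * p.1, t2 * p.2) / joint_tail X Y p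
          @[p --> @min_pinfty R] --> t1 `^ (- a1) * t2 `^ (- a2)].

Definition independent_RVs (d1 d2 : measure_display)
    (T1 : measurableType d1) (T2 : measurableType d2)
    (U : Omega -> T1) (V : Omega -> T2) : Prop :=
  forall (A : set T1) (B : set T2), measurable A -> measurable B ->
    P (U @^-1` A `&` V @^-1` B) = (P (U @^-1` A) * P (V @^-1` B))%E.

Definition rv_mul (U V : {RV P >-> R}) : {RV P >-> R} :=
  (U : {mfun Omega >-> R}) * (V : {mfun Omega >-> R}).

Definition assumption_A (X Y Theta Delta : {RV P >-> R}) : Prop :=
  exists b c : R -> R,
    [/\ (forall x : R, 0 <= x -> 0 < b x) /\ (forall y : R, 0 <= y -> 0 < c y),
        b x @[x --> +oo] --> +oo /\ asym_o +oo b id,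
        c y @[y --> +oo] --> +oo /\ asym_o +oo c id,
        asym_o (@min_pinfty R) (fun p => tail Theta (b p.1))
          (joint_tail (rv_mul Theta X) (rv_mul Delta Y))
      & asym_o (@min_pinfty R) (fun p => tail Delta (c p.2))
          (joint_tail (rv_mul Theta X) (rv_mul Delta Y))].

End probability.

(* Main.v *)
Require Import Defs.
From HB Require Import structures.
From mathcomp Require Import all_boot all_order all_algebra.
From mathcomp Require Import all_classical all_reals all_analysis.
From mathcomp Require Import measurable_realfun.

Import Order.TTheory GRing.Theory Num.Theory.
Import numFieldNormedType.Exports.

Local Open Scope classical_set_scope.
Local Open Scope ring_scope.

(** Assumption A is strong: it forces Theta and Delta to be bounded.  Its
first [o]-relation holds uniformly on a quadrant x, y > M.  Fix x > M there
and let y tend to infinity: P[Theta > b(x)] depends on x alone, while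
P[Theta X > x, Delta Y > y] <= P[Delta Y > y] tends to 0.  So
P[Theta > b(x)] = 0, that is, Theta <= b(x) almost surely; symmetrically for
Delta ([asym_o_joint_tail_bounded_l], [asym_o_joint_tail_bounded_r]).

For weights with values in [0, K], the result is Breiman's argument by
dominated convergence.  Let H(x, y) = P[X > x, Y > y].  By independence,
P[Theta X > x, Delta Y > y] is the mean of H(x / Theta, y / Delta) over the
event that Theta and Delta are positive
([independent_RVs_disintegration]).  After division by H(x, y), the integrand
tends to Theta^alpha1 Delta^alpha2 by regular variation, and it is at most
H(x / K, y / K) / H(x, y), which converges and hence is eventually below a
constant.  Dominated convergence is a statement about sequences; it applies
along x /\ y -> oo because that filter has a countable base
([cvg_along_sequences], [cvg_mixture_ratio]).  The same lemma along x -> oo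
treats each margin.

The limit E[Theta^alpha1 Delta^alpha2] is positive because the joint tail of
the products is eventually positive, so that the product Theta Delta is not
almost surely 0; the constants E[Theta^alpha1] and E[Delta^alpha2] of the
margins are positive because neither weight is almost surely 0.  A function
asymptotic to a positive multiple of H inherits the limits of the ratios of H
([cvg_ratio_comp]), which gives the regular variation of the products. *)

Set Implicit Arguments.
Unset Strict Implicit.
Unset Printing Implicit Defensive.

(** * Limits along filters with a countable base *)

(** The second clause asks for all large [n], so that any sequence of points
chosen in the sets [B n] converges to [L]. *)
Definition countable_base (T : Type) (L : set_system T) (B : nat -> set T) :=
  (forall n, L (B n)) /\
  (forall A, L A -> exists N, forall n, (N <= n)%N -> B n `<=` A).

Lemma countable_base_min_pinfty (R : realType) :
  countable_base (@min_pinfty R)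
    (fun n => [set p | n%:R < Num.min p.1 p.2]).
Proof.
split=> [n|A [M _ MA]]; first by exists n%:R.
exists (Num.bound `|M|) => n Mn p np; apply: MA => //=; apply: le_lt_trans np.
rewrite (le_trans (ler_norm _))// (le_trans (ltW (archi_boundP (normr_ge0 _))))//.
by rewrite ler_nat.
Qed.

Lemma countable_base_pinfty (R : realType) :
  countable_base (+oo : set_system R) (fun n => [set x | n%:R < x]).
Proof.
split=> [n|A [M [_ MA]]]; first exact: nbhs_pinfty_gt.
exists (Num.bound `|M|) => n Mn p np; apply: MA => //=; apply: le_lt_trans np.
rewrite (le_trans (ler_norm _))// (le_trans (ltW (archi_boundP (normr_ge0 _))))//.
by rewrite ler_nat.
Qed.

(** If the limit failed, each [B n `&` E] would contain a point where [F] is at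
distance at least [e] from [l]; these points form a sequence tending to [L].
The set [E] allows a property that holds eventually to be required at every
index, as a domination hypothesis demands. *)
Lemma cvg_along_sequences (R : realType) (T : Type) (L : set_system T)
    {FL : ProperFilter L} (B : nat -> set T) (E : set T) (F : T -> R) (l : R) :
  countable_base L B -> L E ->
  (forall p : nat -> T, (forall n, E (p n)) -> p n @[n --> \oo] --> L ->
     F (p n) @[n --> \oo] --> l) ->
  F p @[p --> L] --> l.
Proof.
move=> [LB Bsub] LE Fseq; apply: contrapT => Fl.
have [e e0 Fe] : exists2 e : R, 0 < e & ~ (\forall p \near L, `|l - F p| < e).
  apply: contrapT => /forall2NP H; apply: Fl; apply/cvgrPdist_lt => e e0.
  by have [|/contrapT] := H e.
have bad n : exists p, [/\ B n p, E p & ~ (`|l - F p| < e)].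
  apply: contrapT => /forallNP H; apply: Fe.
  have LBE : L (B n `&` E) by apply: filterI.
  apply: filterS LBE => p [Bp Ep]; apply: contrapT => Fp; exact: (H p).
have [p pP] := choice bad.
have pL : p n @[n --> \oo] --> L.
  move=> A /Bsub[N NA]; exists N => // n /= Nn.
  by apply: NA Nn _ _; have [] := pP n.
have pE n : E (p n) by have [] := pP n.
have /cvgrPdist_lt/(_ e e0)[N _ NF] := Fseq p pE pL.
by have [_ _] := pP N; apply; exact: (NF N (leqnn N)).
Qed.

(** The exceptional null set in the bound may depend on [p]: along a sequence
only countably many of them occur. *)
Lemma bounded_convergence (d : measure_display) (Omega : measurableType d)
    (R : realType) (P : probability Omega R) (T : Type) (L : set_system T)
    {FL : ProperFilter L} (B : nat -> set T)
    (f : T -> Omega -> R) (g : Omega -> R) (M : R) :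
  countable_base L B ->
  (forall p, measurable_fun setT (f p)) -> measurable_fun setT g ->
  {ae P, forall w, f p w @[p --> L] --> g w} ->
  (\forall p \near L, {ae P, forall w, `|f p w| <= M}) ->
  fine (\int[P]_w (f p w)%:E)%E @[p --> L] --> fine (\int[P]_w (g w)%:E)%E.
Proof.
move=> LB mf mg fg LM; apply: (cvg_along_sequences LB LM) => p pE pL.
have fgE : {ae P, forall w, setT w ->
    (f (p n) w)%:E @[n --> \oo] --> (g w)%:E}.
  apply: filterS fg => w fgw _; apply: cvg_EFin; first exact: nearW.
  exact: (cvg_comp _ _ pL fgw).
have fME : {ae P, forall w n, setT w -> (`|(f (p n) w)%:E| <= (M%:E : \bar R))%E}.
  have : {ae P, forall w, forall n, `|f (p n) w| <= M} by apply/ae_foralln.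
  by apply: filterS => w fM n _; rewrite /= lee_fin.
have [ig _ cv] := dominated_convergence measurableT
  (fun n => (measurable_EFinP _ _).2 (mf (p n))) ((measurable_EFinP _ _).2 mg)
  fgE (finite_measure_integrable_cst P M measurableT) fME.
by apply: fine_cvg; rewrite fineK//; exact: integrable_fin_num.
Qed.

(** * Conditioning on an independent variable *)

(** Independence says that the law of [(U, V)] agrees with the product of the
laws of [U] and [V] on rectangles, hence on all measurable sets; the product
measure of [A] is by definition the integral of the measures of its
sections. *)
Lemma independent_RVs_disintegration (d d1 d2 : measure_display)
    (Omega : measurableType d) (T1 : measurableType d1)
    (T2 : measurableType d2) (R : realType) (P : probability Omega R)
    (U : Omega -> T1) (V : Omega -> T2) (A : set (T1 * T2)) :
  measurable_fun setT U -> measurable_fun setT V ->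
  independent_RVs P U V -> measurable A ->
  measurable_fun setT (fun w => fine (P [set v | A (U w, V v)])) /\
  P [set w | A (U w, V w)] =
    (\int[P]_w (fine (P [set v | A (U w, V v)]))%:E)%E.
Proof.
move=> mU mV UV mA.
pose U' : {mfun Omega >-> T1} := HB.pack U (isMeasurableFun.Build _ _ _ _ U mU).
pose V' : {mfun Omega >-> T2} := HB.pack V (isMeasurableFun.Build _ _ _ _ V mV).
have mUV : measurable_fun setT (fun w => (U w, V w)).
  exact: measurable_fun_pair.
pose UV' : {mfun Omega >-> (T1 * T2)%type} :=
  HB.pack (fun w => (U w, V w)) (isMeasurableFun.Build _ _ _ _ _ mUV).
have sec w : (distribution P V' (xsection A (U w))) = P [set v | A (U w, V v)].
  by rewrite /distribution /pushforward; congr (P _); apply/seteqP; split=> v /=;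
    rewrite /xsection/= inE.
have msec : measurable_fun setT (fun w => P [set v | A (U w, V v)]).
  rewrite -(funext sec).
  by apply: (measurableT_comp (measurable_fun_xsection (distribution P V') mA)).
have finE w : (fine (P [set v | A (U w, V v)]))%:E = P [set v | A (U w, V v)].
  by rewrite -sec fineK// fin_num_measure//; exact: measurable_xsection.
split; first by apply: measurableT_comp msec.
under eq_integral do rewrite finE -sec.
have prodE := @product_measure_unique _ _ _ _ _ (distribution P U')
  (distribution P V') (distribution P UV') UV A mA.
rewrite -[LHS]/(distribution P UV' A) -prodE.
rewrite -[LHS]/(\int[distribution P U']_u
  (distribution P V' \o xsection A) u)%E.
rewrite ge0_integral_distribution//.
exact: measurable_fun_xsection.
Qed.

(** The common core of Breiman's argument for one and for two variables:
given [U], the ratio of the probability of the event [A p] to [q p] tends to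
[g] and is bounded by [M], so dominated convergence applies to its integral
over [U]. *)
Lemma cvg_mixture_ratio (d d1 d2 : measure_display)
    (Omega : measurableType d) (T1 : measurableType d1)
    (T2 : measurableType d2) (R : realType) (P : probability Omega R)
    (U : Omega -> T1) (V : Omega -> T2) (T : Type) (L : set_system T)
    {FL : ProperFilter L} (B : nat -> set T) (A : T -> set (T1 * T2))
    (q : T -> R) (g : Omega -> R) (M : R) :
  countable_base L B ->
  measurable_fun setT U -> measurable_fun setT V -> independent_RVs P U V ->
  (forall p, measurable (A p)) -> measurable_fun setT g ->
  (\forall p \near L, 0 < q p) ->
  {ae P, forall w,
    fine (P [set v | A p (U w, V v)]) / q p @[p --> L] --> g w} ->
  (\forall p \near L,
    {ae P, forall w, fine (P [set v | A p (U w, V v)]) <= M * q p}) ->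
  fine (P [set w | A p (U w, V w)]) / q p @[p --> L]
    --> fine (\int[P]_w (g w)%:E)%E.
Proof.
move=> LB mU mV UV mA mg q0 kg kM.
pose k p w := fine (P [set v | A p (U w, V v)]).
have k0 p w : 0 <= k p w by rewrite /k fine_ge0.
have mk p : measurable_fun setT (k p).
  by have [] := independent_RVs_disintegration mU mV UV (mA p).
have kE p : P [set w | A p (U w, V w)] = (\int[P]_w (k p w)%:E)%E.
  by have [] := independent_RVs_disintegration mU mV UV (mA p).
have mkq p : measurable_fun setT (fun w => k p w / q p) by exact: measurable_funM.
have kqM : \forall p \near L, {ae P, forall w, `|k p w / q p| <= M}.
  apply: filterS2 q0 kM => p q0; apply: filterS => w kM.
  by rewrite ger0_norm ?divr_ge0 ?(ltW q0)// ler_pdivrMr.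
apply: cvg_trans (bounded_convergence LB mkq mg kg kqM).
apply: near_eq_cvg; apply: filterS q0 => p q0.
under eq_integral do rewrite EFinM.
rewrite ge0_integralZr//; first last.
- by rewrite lee_fin invr_ge0 ltW.
- by move=> w _; rewrite lee_fin.
- by apply/measurable_EFinP.
rewrite -kE fineM// fin_num_measure// -[X in measurable X]setTI.
by apply: (measurable_fun_pair mU mV).
Qed.

(** Used with [h] a tail and [s] a scaling: [f (s p) / f p] is the product of
[f (s p) / h (s p)], [h (s p) / h p] and the inverse of [f p / h p], whose
outer factors tend to [c] and to the inverse of [c]. *)
Lemma cvg_ratio_comp (R : realType) (T : Type) (L : set_system T)
    {FL : Filter L} (s : T -> T) (f h : T -> R) (c t : R) :
  s p @[p --> L] --> L -> c != 0 ->
  (\forall p \near L, 0 < h p) ->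
  f p / h p @[p --> L] --> c -> h (s p) / h p @[p --> L] --> t ->
  f (s p) / f p @[p --> L] --> t.
Proof.
move=> sL c0 h0 fh hs.
have -> : t = c * t * c^-1 by rewrite mulrAC mulfV// mul1r.
have fhs : f (s p) / h (s p) @[p --> L] --> c by exact: (cvg_comp _ _ sL fh).
have hs0 : \forall p \near L, 0 < h (s p) by exact: (sL _ h0).
apply: cvg_trans (cvgM (cvgM fhs hs) (cvgV c0 fh)).
apply: near_eq_cvg; apply: filterS2 h0 hs0 => p h0 hs0.
by rewrite /= invf_div !mulrA !mulfVK ?gt_eqF.
Qed.

(** * Tails, powers and expectations *)

Lemma powRV (R : realType) (x a : R) : 0 < x -> x^-1 `^ (- a) = x `^ a.
Proof. by move=> x0; rewrite -powR_inv1 ?ltW// -powRrM mulN1r opprK. Qed.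

Lemma measurable_gt_fun (d : measure_display) (T : measurableType d)
    (R : realType) (f : T -> R) (r : R) :
  measurable_fun setT f -> measurable [set w | r < f w].
Proof.
move=> mf; rewrite -[X in measurable X]setTI.
rewrite (_ : [set w | _] = f @^-1` `]r, +oo[); first exact: mf.
by apply/seteqP; split => w /=; rewrite in_itv/= andbT.
Qed.

Lemma fine_probability_le (d : measure_display) (Omega : measurableType d)
    (R : realType) (P : probability Omega R) (A B : set Omega) :
  measurable A -> measurable B -> A `<=` B -> fine (P A) <= fine (P B).
Proof.
by move=> mA mB AB; rewrite fine_le ?fin_num_measure// le_measure// inE.
Qed.

Lemma fine_expectation_gt0 (d : measure_display) (Omega : measurableType d)
    (R : realType) (P : probability Omega R) (g : Omega -> R) (M : R) :
  measurable_fun setT g -> (forall w, 0 <= g w) ->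
  {ae P, forall w, g w <= M} -> ~ {ae P, forall w, g w = 0} ->
  0 < fine (\int[P]_w (g w)%:E)%E.
Proof.
move=> mg g0 gM gN.
have mEg : measurable_fun setT (EFin \o g) by apply/measurable_EFinP.
have I0 : (0 <= \int[P]_w (g w)%:E)%E.
  by apply: integral_ge0 => w _; rewrite lee_fin.
apply: fine_gt0; apply/andP; split.
  rewrite lt_def I0 andbT; apply/eqP => Ig; apply: gN.
  have /(ae_eq_integral_abs P measurableT mEg) : (\int[P]_w `|(g w)%:E| = 0)%E.
    by rewrite -[RHS]Ig; apply: eq_integral => w _; rewrite gee0_abs ?lee_fin.
  by apply: filterS => w /(_ I) [].
have : (\int[P]_w (g w)%:E <= \int[P]_w (cst `|M|%:E w))%E.
  apply: ae_ge0_le_integral => //.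
  - by move=> w _; rewrite lee_fin.
  - by move=> w _; rewrite lee_fin.
  - by apply: filterS gM => w gM _; rewrite /= lee_fin (le_trans gM)// ler_norm.
move=> /le_lt_trans; apply.
by rewrite integral_cst//= ltey_eq fin_numM// fin_num_measure.
Qed.

Lemma tailE (d : measure_display) (Omega : measurableType d)
    (R : realType) (P : probability Omega R) (X : {RV P >-> R}) (x : R) :
  tail P X x = fine (ccdf X x).
Proof.
rewrite /tail /ccdf /distribution /pushforward; congr (fine (P _)).
by apply/seteqP; split => w /=; rewrite in_itv/= andbT.
Qed.

Lemma distr_fun_tail (d : measure_display) (Omega : measurableType d)
    (R : realType) (P : probability Omega R) (X : {RV P >-> R}) (x : R) :
  1 - distr_fun X x = tail P X x.
Proof.
have := cdf_ccdf_1 X x; rewrite tailE /distr_fun.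
have : cdf X x \is a fin_num by rewrite fin_num_measure.
have : ccdf X x \is a fin_num by rewrite fin_num_measure.
move=> /fineK <- /fineK <-; rewrite -EFinD => -[<-].
by rewrite addrAC subrr add0r.
Qed.

Lemma cvg_tail0 (d : measure_display) (Omega : measurableType d)
    (R : realType) (P : probability Omega R) (X : {RV P >-> R}) :
  tail P X x @[x --> +oo] --> 0.
Proof.
under eq_fun do rewrite tailE.
by apply: fine_cvg; exact: cvg_ccdfy0.
Qed.

(** * Scaling the thresholds *)

Lemma scaled_gt (R : realType) (x y z : R) :
  0 < z -> (x < z * y) = (z^-1 * x < y).
Proof. by move=> z0; rewrite -ltr_pdivrMl. Qed.

(** The bound [z <= K] transfers to [z * y] only for [y >= 0]; here [y] is
positive because [z * y] exceeds the positive threshold [x]. *)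
Lemma bounded_scale_gt (R : realType) (x y z K : R) :
  0 < x -> 0 <= z -> z <= K -> 0 < K -> x < z * y -> K^-1 * x < y.
Proof.
move=> x0 z0 zK K0 xzy; rewrite -scaled_gt// (lt_le_trans xzy)//.
rewrite ler_wpM2r// leNgt; apply/negP => y0.
by move: (lt_trans x0 xzy); rewrite ltNge mulr_ge0_le0// ltW.
Qed.

Lemma cvg_scale_pinfty (R : realType) (t : R) :
  0 < t -> t * x @[x --> +oo] --> +oo.
Proof. by move=> t0; apply: gt0_cvgMry => //; exact: cvg_id. Qed.

Lemma cvg_scale_min_pinfty (R : realType) (t1 t2 : R) :
  0 < t1 -> 0 < t2 ->
  (t1 * p.1, t2 * p.2) @[p --> @min_pinfty R] --> @min_pinfty R.
Proof.
move=> t10 t20 A [M _ MA].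
exists (Num.max (t1^-1 * M) (t2^-1 * M)) => // -[x y] /=.
rewrite gt_max !lt_min => /andP[/andP[x1 y1] /andP[x2 y2]]; apply: MA => /=.
by rewrite lt_min !scaled_gt// x1 y2.
Qed.

Lemma min_pinfty_gt {R : realType} (M : R) :
  \forall p \near @min_pinfty R, M < p.1 /\ M < p.2.
Proof. by exists M => // p /=; rewrite lt_min => /andP. Qed.

(** * Breiman's lemma for bounded weights *)

Section product_tails.
Context (d : measure_display) (Omega : measurableType d) (R : realType)
  (P : probability Omega R).
Implicit Types X Y Theta Delta : {RV P >-> R}.

(** Given [Theta w = z > 0], the conditional tail is the tail of [X] at
[z^-1 * x], whose ratio to the tail at [x] tends to [z^-1 `^ (- alpha)], that
is, to [z `^ alpha]. *)
Lemma tail_product_cvg X Theta (alpha K : R) :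
  0 < alpha -> regularly_varying (distr_fun X) alpha ->
  independent_RVs P Theta X -> 0 < K ->
  {ae P, forall w, 0 <= Theta w <= K} ->
  tail P (rv_mul Theta X) x / tail P X x @[x --> +oo] -->
    fine (\int[P]_w (Theta w `^ alpha)%:E)%E.
Proof.
move=> alpha0 [X0 XRV] indep K0 ThetaK.
have tX0 x : 0 < tail P X x by rewrite -distr_fun_tail.
have tXRV t : 0 < t ->
    tail P X (t * x) / tail P X x @[x --> +oo] --> t `^ (- alpha).
  by move=> /XRV; under eq_fun do rewrite !distr_fun_tail.
have K'0 : 0 < K^-1 by rewrite invr_gt0.
have mtail x (Z : {RV P >-> R}) : measurable [set w | x < Z w].
  exact: measurable_gt_fun.
apply: (cvg_mixture_ratio (U := Theta) (V := X)
  (A := fun x : R => [set z : R * R | x < z.1 * z.2])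
  (M := K^-1 `^ (- alpha) + 1) (countable_base_pinfty R)) => //.
- move=> x; apply: measurable_gt_fun; exact: measurable_funM.
- exact: (measurableT_comp (measurable_powR alpha) (measurable_funPT Theta)).
- by near=> x.
- apply: filterS ThetaK => w /andP[+ _]; rewrite le_eqVlt => /predU1P[<-|w0].
    (* A zero weight never exceeds a positive threshold. *)
    rewrite powR0 ?gt_eqF//; apply: cvg_near_cst; near=> x.
    rewrite (_ : [set v | _] = set0) ?measure0 ?mul0r//.
    apply/seteqP; split=> v //=; rewrite mul0r ltNge => /negP; apply.
    by near: x; exact: nbhs_pinfty_ge.
  rewrite -powRV//; under eq_fun do under eq_set do rewrite /= scaled_gt//.
  by apply: tXRV; rewrite invr_gt0.
- have lt1 : K^-1 `^ (- alpha) < K^-1 `^ (- alpha) + 1 by rewrite ltrDl.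
  have near_tail := cvgr_lt _ (tXRV _ K'0) _ lt1.
  near=> x; apply: filterS ThetaK => w /andP[w0 wK].
  have x0 : 0 < x by near: x; exact: nbhs_pinfty_gt.
  apply: (@le_trans _ _ (tail P X (K^-1 * x))).
    apply: fine_probability_le => //.
      by apply: measurable_gt_fun; exact: measurable_funM.
    by move=> v /=; exact: bounded_scale_gt.
  by rewrite -ler_pdivrMr//; apply: ltW; near: x; exact: near_tail.
Unshelve. all: by end_near. Qed.

(** The two weights may depend on each other in any way: for fixed values of
both in [0, K], joint regular variation applies with the two scalings given by their
inverses, and the value [K^-1] gives the lowest thresholds, hence the bound. *)
Lemma joint_tail_product_cvg X Y Theta Delta (alpha1 alpha2 K : R) :
  0 < alpha1 -> 0 < alpha2 -> bi_regularly_varying X Y alpha1 alpha2 ->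
  independent_RVs P (fun w => (Theta w, Delta w)) (fun w => (X w, Y w)) ->
  0 < K ->
  {ae P, forall w, 0 <= Theta w <= K} -> {ae P, forall w, 0 <= Delta w <= K} ->
  joint_tail P (rv_mul Theta X) (rv_mul Delta Y) p / joint_tail P X Y p
    @[p --> @min_pinfty R] -->
    fine (\int[P]_w (Theta w `^ alpha1 * Delta w `^ alpha2)%:E)%E.
Proof.
move=> a10 a20 [_ _ J0 JRV] indep K0 ThetaK DeltaK.
have K'0 : 0 < K^-1 by rewrite invr_gt0.
have mjoint x y (Z1 Z2 : {RV P >-> R}) :
    measurable [set w | x < Z1 w /\ y < Z2 w].
  by apply: measurableI; exact: measurable_gt_fun.
have mpow (Z : {RV P >-> R}) a : measurable_fun setT (fun w => Z w `^ a).
  exact: (measurableT_comp (measurable_powR a) (measurable_funPT Z)).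
apply: (cvg_mixture_ratio (U := fun w => (Theta w, Delta w))
  (V := fun w => (X w, Y w))
  (A := fun p : R * R => [set z : (R * R) * (R * R) |
     p.1 < z.1.1 * z.2.1 /\ p.2 < z.1.2 * z.2.2])
  (M := K^-1 `^ (- alpha1) * K^-1 `^ (- alpha2) + 1)
  (countable_base_min_pinfty R)) => //.
- exact: measurable_fun_pair.
- exact: measurable_fun_pair.
- move=> p; apply: measurableI; apply: measurable_gt_fun;
    apply: measurable_funM; apply: measurableT_comp => //;
    exact: measurableT_comp.
- exact: measurable_funM.
- apply: filterS2 ThetaK DeltaK => w /andP[w0 _] /andP[z0 _].
  have [->|Theta_neq0] := eqVneq (Theta w) 0.
    rewrite powR0 ?gt_eqF// mul0r; apply: cvg_near_cst.
    apply: filterS (min_pinfty_gt (0 : R)) => p [p10 _].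
    rewrite (_ : [set v | _] = set0) ?measure0 ?mul0r//.
    by apply/seteqP; split=> v //= -[]; rewrite mul0r ltNge ltW.
  have [->|Delta_neq0] := eqVneq (Delta w) 0.
    rewrite [X in _ * X]powR0 ?gt_eqF// mulr0; apply: cvg_near_cst.
    apply: filterS (min_pinfty_gt (0 : R)) => p [_ p20].
    rewrite (_ : [set v | _] = set0) ?measure0 ?mul0r//.
    by apply/seteqP; split=> v //= -[_]; rewrite mul0r ltNge ltW.
  have Theta0 : 0 < Theta w by rewrite lt_def Theta_neq0.
  have Delta0 : 0 < Delta w by rewrite lt_def Delta_neq0.
  rewrite -powRV// -(powRV alpha2)//.
  under eq_fun do under eq_set do rewrite /= !scaled_gt//.
  by apply: JRV; rewrite invr_gt0.
- have lt1 : K^-1 `^ (- alpha1) * K^-1 `^ (- alpha2) <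
    K^-1 `^ (- alpha1) * K^-1 `^ (- alpha2) + 1 by rewrite ltrDl.
  have near_tail : \forall p \near @min_pinfty R,
      joint_tail P X Y (K^-1 * p.1, K^-1 * p.2) / joint_tail P X Y p <
      K^-1 `^ (- alpha1) * K^-1 `^ (- alpha2) + 1.
    exact: cvgr_lt _ (JRV _ _ K'0 K'0) _ lt1.
  apply: filterS3 (min_pinfty_gt (0 : R)) J0 near_tail => p [p10 p20] Jp0 Jp.
  apply: filterS2 ThetaK DeltaK => w /andP[w0 wK] /andP[z0 zK].
  apply: (@le_trans _ _ (joint_tail P X Y (K^-1 * p.1, K^-1 * p.2))).
    apply: fine_probability_le => //.
      by apply: measurableI; apply: measurable_gt_fun; exact: measurable_funM.
    move=> v /= [Xv Yv]; split; first exact: (bounded_scale_gt p10 w0 wK K0 Xv).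
    exact: (bounded_scale_gt p20 z0 zK K0 Yv).
  by rewrite -ler_pdivrMr// ltW.
Qed.

(** * Assumption A makes the weights bounded *)

Lemma asym_o_min_pinfty_lt (f J : R * R -> R) :
  asym_o (@min_pinfty R) f J ->
  exists M : R, forall p, M < p.1 -> M < p.2 -> f p < J p.
Proof.
move=> [J0 fJ].
have [M _ ltM] : \forall p \near @min_pinfty R, f p < J p.
  have fJ1 : \forall p \near @min_pinfty R, f p / J p < 1.
    exact: cvgr_lt _ fJ _ ltr01.
  by apply: filterS2 J0 fJ1 => p Jp0; rewrite ltr_pdivrMr// mul1r.
by exists M => p Mp1 Mp2; apply: ltM => /=; rewrite lt_min Mp1.
Qed.

Lemma joint_tail_le_l X Y x y : joint_tail P X Y (x, y) <= tail P X x.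
Proof.
apply: fine_probability_le; [apply: measurableI| |by move=> w []];
  exact: measurable_gt_fun.
Qed.

Lemma joint_tail_le_r X Y x y : joint_tail P X Y (x, y) <= tail P Y y.
Proof.
apply: fine_probability_le; [apply: measurableI| |by move=> w []];
  exact: measurable_gt_fun.
Qed.

Lemma tail_le0_bounded X (K : R) :
  tail P X K <= 0 -> {ae P, forall w, X w <= K}.
Proof.
move=> X0; have mK : measurable [set w | K < X w] by exact: measurable_gt_fun.
exists [set w | K < X w]; split => //.
  apply/eqP; rewrite -fine_eq0 ?fin_num_measure//.
  by rewrite eq_le [X in X && _]X0 fine_ge0.
by move=> w /= /negP; rewrite -ltNge.
Qed.

(** The left side depends on [p.1] only.  With [p.1] fixed beyond the threshold,
the joint tail on the right is at most the tail of [Y] at [p.2], which vanishes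
as [p.2] grows. *)
Lemma asym_o_joint_tail_bounded_l X Y (Z : {RV P >-> R}) (b : R -> R) :
  asym_o (@min_pinfty R) (fun p => tail P Z (b p.1)) (joint_tail P X Y) ->
  exists K, {ae P, forall w, Z w <= K}.
Proof.
move=> /asym_o_min_pinfty_lt[M ltM]; exists (b (M + 1)).
apply: tail_le0_bounded.
apply: (cvgr_to_ge (cvg_tail0 Y)); near=> y.
have My : M < y by near: y; exact: nbhs_pinfty_gt (num_real _).
apply: le_trans (joint_tail_le_r X Y _ _); apply: ltW.
by apply: (ltM (M + 1, y)) => //=; rewrite ltrDl.
Unshelve. all: by end_near. Qed.

Lemma asym_o_joint_tail_bounded_r X Y (Z : {RV P >-> R}) (c : R -> R) :
  asym_o (@min_pinfty R) (fun p => tail P Z (c p.2)) (joint_tail P X Y) ->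
  exists K, {ae P, forall w, Z w <= K}.
Proof.
move=> /asym_o_min_pinfty_lt[M ltM]; exists (c (M + 1)).
apply: tail_le0_bounded.
apply: (cvgr_to_ge (cvg_tail0 X)); near=> x.
have Mx : M < x by near: x; exact: nbhs_pinfty_gt (num_real _).
apply: le_trans (joint_tail_le_l X Y _ _); apply: ltW.
by apply: (ltM (x, M + 1)) => //=; rewrite ltrDl.
Unshelve. all: by end_near. Qed.

(** * Regular variation of the products *)

Lemma regularly_varying_product X Theta (alpha K : R) :
  0 < alpha -> regularly_varying (distr_fun X) alpha ->
  independent_RVs P Theta X -> 0 < K ->
  {ae P, forall w, 0 <= Theta w <= K} -> ~ {ae P, forall w, Theta w = 0} ->
  regularly_varying (distr_fun (rv_mul Theta X)) alpha.
Proof.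
move=> alpha0 XRV indep K0 ThetaK ThetaN.
have [X0 Xcvg] := XRV.
pose c := fine (\int[P]_w (Theta w `^ alpha)%:E)%E.
have Breiman : tail P (rv_mul Theta X) x / tail P X x @[x --> +oo] --> c.
  exact: (tail_product_cvg alpha0 XRV indep K0 ThetaK).
have c0 : 0 < c.
  apply: (@fine_expectation_gt0 _ _ _ _ _ (K `^ alpha)).
  - exact: (measurableT_comp (measurable_powR alpha) (measurable_funPT Theta)).
  - by move=> w; exact: powR_ge0.
  - apply: filterS ThetaK => w /andP[w0 wK].
    by rewrite ge0_ler_powR// ?nnegrE ?ltW.
  - move=> pow0; apply: ThetaN; apply: filterS pow0 => w /eqP.
    by rewrite powR_eq0 => /andP[/eqP].
have tX0 x : 0 < tail P X x by rewrite -distr_fun_tail.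
split=> [x|t t0]; last first.
  under eq_fun do rewrite !distr_fun_tail.
  apply: (cvg_ratio_comp (cvg_scale_pinfty t0) _ _ Breiman).
  - by rewrite gt_eqF.
  - by near=> x.
  - by have := Xcvg t t0; under eq_fun do rewrite !distr_fun_tail.
rewrite distr_fun_tail.
(* The tail is positive far out by the asymptotics; being nonincreasing, it is
   positive everywhere. *)
have near_pos : \forall y \near +oo, 0 < tail P (rv_mul Theta X) y.
  have near_ratio : \forall y \near +oo,
      0 < tail P (rv_mul Theta X) y / tail P X y.
    exact: cvgr_gt _ Breiman _ c0.
  by apply: filterS near_ratio => y; rewrite pmulr_lgt0// invr_gt0.
near (+oo : set_system R) => y.
apply: (@lt_le_trans _ _ (tail P (rv_mul Theta X) y)); first by near: y.
apply: fine_probability_le; [exact: measurable_gt_fun..|].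
by move=> w /=; apply: lt_trans; near: y; exact: nbhs_pinfty_gt (num_real _).
Unshelve. all: by end_near. Qed.

End product_tails.

Lemma independent_RVs_comp (d d1 d2 d3 d4 : measure_display)
    (Omega : measurableType d) (T1 : measurableType d1)
    (T2 : measurableType d2) (T3 : measurableType d3)
    (T4 : measurableType d4) (R : realType) (P : probability Omega R)
    (U : Omega -> T1) (V : Omega -> T2) (f : T1 -> T3) (g : T2 -> T4) :
  independent_RVs P U V -> measurable_fun setT f -> measurable_fun setT g ->
  independent_RVs P (f \o U) (g \o V).
Proof.
move=> UV mf mg A B mA mB; apply: (UV (f @^-1` A) (g @^-1` B)).
  by rewrite -[X in measurable X]setTI; exact: mf.
by rewrite -[X in measurable X]setTI; exact: mg.
Qed.

Unset Implicit Arguments.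
Set Strict Implicit.
Set Printing Implicit Defensive.

Theorem lemma4p2 (d : measure_display) (Omega : measurableType d)
    (R : realType) (P : probability Omega R)
    (X Y Theta Delta : {RV P >-> R}) (alpha1 alpha2 : R)
    (alpha1_gt0 : 0 < alpha1) (alpha2_gt0 : 0 < alpha2)
    (X_RV : regularly_varying (distr_fun X) alpha1)
    (Y_RV : regularly_varying (distr_fun Y) alpha2)
    (XY_RV : bi_regularly_varying X Y alpha1 alpha2)
    (indep : independent_RVs P (fun w => (Theta w, Delta w))
                               (fun w => (X w, Y w)))
    (Theta_ge0 : {ae P, forall w, 0 <= Theta w})
    (Delta_ge0 : {ae P, forall w, 0 <= Delta w})
    (Theta_neq0 : ~ {ae P, forall w, Theta w = 0})
    (Delta_neq0 : ~ {ae P, forall w, Delta w = 0})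
    (moment : exists2 eps : R, 0 < eps &
      ('E_P[fun w => (Theta w `^ (alpha1 + eps)
                         * Delta w `^ (alpha2 + eps))%R]
         < +oo)%E)
    (hA : assumption_A X Y Theta Delta) :
  asym_equiv (@min_pinfty R)
    (joint_tail P (rv_mul Theta X) (rv_mul Delta Y))
    (fun p => fine ('E_P[fun w => (Theta w `^ alpha1 * Delta w `^ alpha2)%R])
              * joint_tail P X Y p) /\
  bi_regularly_varying (rv_mul Theta X) (rv_mul Delta Y) alpha1 alpha2.
Proof.
have [b [c [_ _ _ Theta_o Delta_o]]] := hA.
have [K1 ThetaK1] := asym_o_joint_tail_bounded_l Theta_o.
have [K2 DeltaK2] := asym_o_joint_tail_bounded_r Delta_o.
(* The maximum with 1 makes K positive even if both weights are bounded by a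
   nonpositive constant. *)
pose K := Num.max 1 (Num.max K1 K2).
have K0 : 0 < K by rewrite lt_max ltr01.
have ThetaK : {ae P, forall w, 0 <= Theta w <= K}.
  apply: filterS2 Theta_ge0 ThetaK1 => w -> wK.
  by rewrite !le_max wK orbT.
have DeltaK : {ae P, forall w, 0 <= Delta w <= K}.
  apply: filterS2 Delta_ge0 DeltaK2 => w -> wK.
  by rewrite !le_max wK !orbT.
have ThetaX : independent_RVs P Theta X.
  exact: (independent_RVs_comp indep measurable_fst measurable_fst).
have DeltaY : independent_RVs P Delta Y.
  exact: (independent_RVs_comp indep measurable_snd measurable_snd).
have [J0 _] := Theta_o.
have [_ _ H0 HRV] := XY_RV.
pose J := joint_tail P (rv_mul Theta X) (rv_mul Delta Y).
pose g w := Theta w `^ alpha1 * Delta w `^ alpha2.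
pose C := fine (\int[P]_w (g w)%:E)%E.
have JH : J p / joint_tail P X Y p @[p --> @min_pinfty R] --> C.
  exact: joint_tail_product_cvg XY_RV indep K0 ThetaK DeltaK.
have mpow (Z : {RV P >-> R}) a : measurable_fun setT (fun w => Z w `^ a).
  exact: (measurableT_comp (measurable_powR a) (measurable_funPT Z)).
(* Where g vanishes, Theta or Delta vanishes, so one of the products is 0;
   were g null almost surely, the joint tail would be 0 at positive levels. *)
have gN : ~ {ae P, forall w, g w = 0}.
  move=> g0.
  have [p [[p10 p20] Jp]] := filter_ex (filterI (min_pinfty_gt (0 : R)) J0).
  move: Jp; rewrite /joint_tail measure_negligible ?ltxx//.
    by apply: measurableI; exact: measurable_gt_fun.
  apply: negligibleS g0 => w /= [Xw Yw] /eqP.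
  rewrite mulf_eq0 !powR_eq0 => /orP[] /andP[/eqP w0 _].
    by have : p.1 < Theta w * X w := Xw; rewrite w0 mul0r ltNge ltW.
  by have : p.2 < Delta w * Y w := Yw; rewrite w0 mul0r ltNge ltW.
have C0 : 0 < C.
  apply: (@fine_expectation_gt0 _ _ _ _ _ (K `^ alpha1 * K `^ alpha2)) => //.
  - exact: measurable_funM.
  - by move=> w; rewrite mulr_ge0 ?powR_ge0.
  - apply: filterS2 ThetaK DeltaK => w /andP[w0 wK] /andP[z0 zK].
    by rewrite ler_pM ?powR_ge0// ge0_ler_powR// ?nnegrE ltW.
split.
  rewrite unlock -/g -/C; split=> //.
    by apply: filterS H0 => p; rewrite pmulr_rgt0.
  have -> : (1 : R) = C * C^-1 by rewrite divff ?gt_eqF.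
  under eq_fun do rewrite invfM mulrCA mulrC.
  exact: cvgM JH (cvg_cst _).
split=> //.
- exact: regularly_varying_product X_RV ThetaX K0 ThetaK Theta_neq0.
- exact: regularly_varying_product Y_RV DeltaY K0 DeltaK Delta_neq0.
move=> t1 t2 t10 t20.
apply: (cvg_ratio_comp (cvg_scale_min_pinfty t10 t20) _ H0 JH (HRV _ _ t10 t20)).
by rewrite gt_eqF.
Qed.
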